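(* Let $k_1,k_2$ be natural numbers, $a,b,c_1,c_2,t_1,t_2\in\mathbb{C}$, and $r\ge1$ an integer. Then $$\left(\frac{\partial}{\partial x}\right)^r\left[x^{b+r-1}\mathcal{F}^{(1)}_4(a,b;c_1,c_2;t_1,t_2,k_1,k_2,x,xy)\right]=x^{b-1}(b)_r\,\mathcal{F}^{(1)}_4(a,b+r;c_1,c_2;t_1,t_2,k_1,k_2,x,xy);$$ $$\left(\frac{\partial}{\partial y}\right)^r\left[y^{b+r-1}\mathcal{F}^{(1)}_4(a,b;c_1,c_2;t_1,t_2,k_1,k_2,xy,y)\right]=y^{b-1}(b)_r\,\mathcal{F}^{(1)}_4(a,b+r;c_1,c_2;t_1,t_2,k_1,k_2,xy,y);$$ $$\left(\frac{\partial}{\partial x}\right)^r\left[x^{a+r-1}\mathcal{F}^{(1)}_4(a,b;c_1,c_2;t_1,t_2,k_1,k_2,x,xy)\right]=x^{a-1}(a)_r\,\mathcal{F}^{(1)}_4(a+r,b;c_1,c_2;t_1,t_2,k_1,k_2,x,xy);$$ $$\left(\frac{\partial}{\partial y}\right)^r\left[y^{a+r-1}\mathcal{F}^{(1)}_4(a,b;c_1,c_2;t_1,t_2,k_1,k_2,xy,y)\right]=y^{a-1}(a)_r\,\mathcal{F}^{(1)}_4(a+r,b;c_1,c_2;t_1,t_2,k_1,k_2,xy,y);$$ $$\left(\frac{\partial}{\partial x}\right)^r\left[x^{c_1-1}\mathcal{F}^{(1)}_4(a,b;c_1,c_2;t_1,t_2,k_1,k_2,x,y)\right]=(-1)^r(1-c_1)_r\,x^{c_1-r-1}\mathcal{F}^{(1)}_4(a,b;c_1-r,c_2;t_1,t_2,k_1,k_2,x,y);$$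 $$\left(\frac{\partial}{\partial y}\right)^r\left[y^{c_2-1}\mathcal{F}^{(1)}_4(a,b;c_1,c_2;t_1,t_2,k_1,k_2,x,y)\right]=(-1)^r(1-c_2)_r\,y^{c_2-r-1}\mathcal{F}^{(1)}_4(a,b;c_1,c_2-r;t_1,t_2,k_1,k_2,x,y).$$
   Context: For $a\in\mathbb{C}$ the shifted factorial is $(a)_0=1$ and $(a)_l=a(a+1)\cdots(a+l-1)$ for $l\ge1$. For complex $a,b,c_1,c_2,t_1,t_2$ and natural numbers $k_1,k_2$, the first discrete Appell function is $$\mathcal{F}^{(1)}_4(a,b;c_1,c_2;t_1,t_2,k_1,k_2,x,y)=\sum_{m,n\ge0}\frac{(a)_{m+n}(b)_{m+n}(-1)^{mk_1}(-t_1)_{mk_1}(-1)^{nk_2}(-t_2)_{nk_2}}{(c_1)_m(c_2)_n\,m!\,n!}\,x^my^n.$$ In every function $\mathcal{F}^{(1)}_4$ that appears, the real parts of the two lower parameters are assumed different from $0,-1,-2,\dots$. The series is regarded as an absolutely convergent function of its last two arguments $x,y$ in the region $\sqrt{|x|}+\sqrt{|y|}<1$. *)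

(* Defs.v *)
From HB Require Import structures.
From mathcomp Require Import all_boot all_order all_algebra.
From mathcomp Require Import all_classical all_reals all_analysis.
From mathcomp Require Import complex.

Set Implicit Arguments.
Unset Strict Implicit.
Unset Printing Implicit Defensive.

Import Order.TTheory GRing.Theory Num.Theory.
Import numFieldNormedType.Exports.

Local Open Scope classical_set_scope.
Local Open Scope ring_scope.
Local Open Scope complex_scope.

Section DiscreteAppell.
Variable R : realType.
(* The regular copy [R[i]^o] carries the topology of the modulus and is a
   normed space over [R[i]], so [derivable] and [derive1n] are complex
   differentiability and the iterated complex derivative. *)
Local Notation C := (R[i]^o).

Definition poch (a : C) (l : nat) : C := \prod_(i < l) (a + i%:R).

Definition F41_term (a b c1 c2 t1 t2 : C) (k1 k2 : nat) (x y : C)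
    (m n : nat) : C :=
  poch a (m + n) * poch b (m + n)
    * (-1) ^+ (m * k1) * poch (- t1) (m * k1)
    * (-1) ^+ (n * k2) * poch (- t2) (n * k2)
    / (poch c1 m * poch c2 n * m`!%:R * n`!%:R)
    * x ^+ m * y ^+ n.

Definition F41_region (x y : C) : Prop := sqrtC `|x| + sqrtC `|y| < 1.

(* Square partial sums determine both the convergence of a double series of
   nonnegative terms and the sum of an absolutely convergent double series. *)
Definition F41_abs_cvg (a b c1 c2 t1 t2 : C) (k1 k2 : nat) : Prop :=
  forall x y : C, F41_region x y ->
    cvgn (fun N : nat => \sum_(m < N) \sum_(n < N)
      `|F41_term a b c1 c2 t1 t2 k1 k2 x y m n| : C).

Definition F41 (a b c1 c2 t1 t2 : C) (k1 k2 : nat) (x y : C) : C :=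
  limn (fun N : nat => \sum_(m < N) \sum_(n < N)
    F41_term a b c1 c2 t1 t2 k1 k2 x y m n : C).

Definition admissible_lower (c : C) : Prop :=
  forall n : nat, complex.Re c != - n%:R.

Definition cexp (z : C) : C :=
  (expR (complex.Re z) * cos (complex.Im z))
    +i* (expR (complex.Re z) * sin (complex.Im z)).

(* [L] is a branch of the logarithm on the open set [U]; necessarily 0 is not
   in [U]. The principal branch on the slit plane is one instance. *)
Definition log_branch (U : set C) (L : C -> C) : Prop :=
  [/\ open U,
      forall z, U z -> {for z, continuous L} &
      forall z, U z -> cexp (L z) = z].

Definition cpow (L : C -> C) (s z : C) : C := cexp (s * L z).

(* [derive1n] is total, so the differentiability that gives the value its
   meaning is required explicitly, on a neighbourhood of [z]. *)
Definition is_nth_deriv (r : nat) (f : C -> C) (z l : C) : Prop :=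
  (forall k, (k < r)%N -> \forall w \near z, derivable (derive1n k f) w 1)
  /\ derive1n r f z = l.

End DiscreteAppell.

(* Main.v *)
Require Import Defs.
From mathcomp Require Import all_boot all_order all_algebra.
From mathcomp Require Import all_classical all_reals all_analysis.
From mathcomp Require Import complex.
From mathcomp Require Import ring lra.

Import Order.TTheory GRing.Theory Num.Theory.
Import numFieldNormedType.Exports.

Local Open Scope classical_set_scope.
Local Open Scope ring_scope.
Local Open Scope complex_scope.

(** Multiplying the series by a power of the variable turns differentiation into
    multiplication of coefficients: z ^ (s + e) has derivative
    (s + e) z ^ (s + e - 1), so the r-th derivative of z ^ s times the sum of
    u_(m,n) z ^ e(m,n) is z ^ (s - r) times the sum whose coefficients carry the
    falling product of the s - j + e(m,n), for j < r. On the lines (z, z y) and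
    (z, y) the weight e is m + n and m, and the falling products become shifted
    factorials that shift the parameter b or c1. The identities for a and for
    the second variable follow from the symmetries of the function.

    The analytic content is that this computation may be done term by term.
    Absolute convergence gives bounded absolute square sums at every radius
    inside the disc of convergence; an Euler factor s + e is absorbed by a
    slightly larger radius ([euler_factor_bound]), and the second-order remainder
    of each monomial is controlled uniformly in the exponent
    ([exprD_remainder]). So differentiability is obtained on square partial sums
    and passed to the limit ([is_derive_dpower_series]), and no rearrangement of
    the double series is ever made. The power is cexp (s * L z) for a branch L of
    the logarithm, which is only assumed to be continuous; that L' = 1/z is
    [is_derive_log_branch]. [is_nth_deriv_cpow_dpower_series] combines the two
    parts by induction on r. *)

(** * Double series summed over squares *)

Definition sq_sum {V : nmodType} (v : nat -> nat -> V) (N : nat) : V :=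
  \sum_(m < N) \sum_(n < N) v m n.

Definition sq_summable {K : numDomainType} (v : nat -> nat -> K) : Prop :=
  exists M, forall N, sq_sum (fun m n => `|v m n|) N <= M.

Section SquareSums.
Context {R : realType}.
Local Notation C := (R[i]^o).

Lemma sq_sum_nondecreasing (K : numDomainType) (v : nat -> nat -> K) :
  (forall m n, 0 <= v m n) ->
  {homo sq_sum v : N N' / (N <= N')%N >-> N <= N'}.
Proof.
move=> v0 N N' NN'; rewrite /sq_sum.
rewrite (big_ord_widen N' (fun m => \sum_(n < N) v m n))//.
rewrite big_mkcond/=; apply: ler_sum => m _.
case: ifP => _; last by apply: sumr_ge0.
rewrite (big_ord_widen N' (fun n => v m n))// big_mkcond/=.
by apply: ler_sum => n _; case: ifP.
Qed.

(** v is the difference of |v| + v and |v|, two nonnegative families whose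
    square sums are monotone and bounded. *)
Lemma real_sq_summable_cvg (v : nat -> nat -> R) :
  sq_summable v -> cvgn (sq_sum v).
Proof.
move=> [M vM].
have cvgp (w : nat -> nat -> R) : (forall m n, 0 <= w m n) ->
    (forall m n, w m n <= 2 * `|v m n|) -> cvgn (sq_sum w).
  move=> w0 wv; apply: nondecreasing_is_cvgn.
    exact: sq_sum_nondecreasing.
  exists (2 * M) => _ [N _ <-].
  apply: (@le_trans _ _ (2 * sq_sum (fun m n => `|v m n|) N)); last first.
    by rewrite ler_pM2l.
  rewrite /sq_sum mulr_sumr ler_sum// => m _.
  by rewrite mulr_sumr ler_sum.
have -> : sq_sum v = (fun N => sq_sum (fun m n => `|v m n| + v m n) N
    - sq_sum (fun m n => `|v m n|) N).
  apply/funext => N; rewrite /sq_sum -sumrB; apply: eq_bigr => m _.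
  by rewrite -sumrB; apply: eq_bigr => n _; rewrite [_ + v m n]addrC addrK.
apply: is_cvgB; apply: cvgp => m n //.
- by have := ler_norm (- v m n); rewrite normrN; lra.
- by have := ler_norm (v m n); lra.
- by have := normr_ge0 (v m n); lra.
Qed.

Lemma norm_real_complex (x : R) : `|x%:C| = `|x|%:C.
Proof. by rewrite normc_def/= expr0n/= addr0 sqrtr_sqr. Qed.

Lemma normc_ge_Im (z : R[i]) : `|complex.Im z|%:C <= `|z|.
Proof.
have := normc_ge_Re (z * 'i%C).
by rewrite ReiNIm normrN complexiE normrM normCi mulr1.
Qed.

Lemma norm_complex_le (z : C) :
  `|z| <= (`|complex.Re z| + `|complex.Im z|)%:C.
Proof.
rewrite {1}(complexE z) (le_trans (ler_normD _ _))// normrM.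
by rewrite complexiE normCi mul1r !norm_real_complex -rmorphD.
Qed.

Lemma cvgn_complex (x y : nat -> R) :
  cvgn x -> cvgn y -> cvgn ((fun n => x n +i* y n) : nat -> C).
Proof.
move=> /cvgrPdist_lt xl /cvgrPdist_lt yl.
apply/cvg_ex; exists (limn x +i* limn y); apply/cvgrPdist_lt => e e0.
have e0' : 0 < complex.Re e / 2 by move: e0; rewrite ltcE => /andP[_ /=]; lra.
have eE : e = (complex.Re e)%:C by rewrite RRe_real// gtr0_real.
near=> n.
apply: le_lt_trans (norm_complex_le _) _.
rewrite eE ltcR /=.
have : `|limn x - x n| < complex.Re e / 2 by near: n; exact: xl.
have : `|limn y - y n| < complex.Re e / 2 by near: n; exact: yl.
lra.
Unshelve. all: by end_near. Qed.

(** Completeness of the complex plane enters through the real and imaginary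
    parts. *)
Lemma sq_summable_cvg (v : nat -> nat -> C) :
  sq_summable v -> cvgn (sq_sum v : nat -> C).
Proof.
move=> [M vM].
have M0 : 0 <= M by apply: le_trans (vM 0%N); rewrite /sq_sum big_ord0.
have ME : M = (complex.Re M)%:C by rewrite RRe_real// ger0_real.
have part (p : C -> R) : (forall z, `|p z|%:C <= `|z|) ->
    cvgn (sq_sum (fun m n => p (v m n))).
  move=> pz; apply: real_sq_summable_cvg; exists (complex.Re M) => N.
  rewrite -lecR -ME; apply: le_trans (vM N).
  rewrite /sq_sum rmorph_sum/= ler_sum// => m _.
  by rewrite rmorph_sum/= ler_sum.
have cRe := part _ (fun z => normc_ge_Re z).
have cIm : cvgn (sq_sum (fun m n => complex.Im (v m n))).
  by apply: part => z; exact: normc_ge_Im.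
rewrite (_ : sq_sum v = fun N => sq_sum (fun m n => complex.Re (v m n)) N
   +i* sq_sum (fun m n => complex.Im (v m n)) N); first exact: cvgn_complex.
apply/funext => N; rewrite /sq_sum.
by apply/eqP; rewrite eq_complex/= !raddf_sum/=; apply/andP; split; apply/eqP;
  apply: eq_bigr => m _; rewrite raddf_sum.
Qed.

Lemma cvgn_sq_summable (v : nat -> nat -> C) :
  cvgn (sq_sum (fun m n => `|v m n|) : nat -> C) -> sq_summable v.
Proof.
move=> /cvg_seq_bounded [M [Mr Mb]]; exists (M + 1) => N.
apply: le_trans (Mb (M + 1) _ N I); last by rewrite ltrDl.
apply: real_ler_norm; apply: ger0_real.
by apply: sumr_ge0 => m _; apply: sumr_ge0.
Qed.

(** The order on the complex numbers is partial, but a norm and an upper bound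
    of a norm are both real, hence comparable. *)
Lemma limn_norm_le (x : nat -> C) (l M : C) :
  x n @[n --> \oo] --> l -> (forall n, `|x n| <= M) -> `|l| <= M.
Proof.
move=> /cvgrPdist_lt xl xM.
have M0 : 0 <= M by exact: le_trans (xM 0%N).
rewrite real_leNgt ?normr_real ?ger0_real//; apply/negP => Ml.
have /xl[n _ /(_ n (leqnn n))] : 0 < `|l| - M by rewrite subr_gt0.
apply/negP; rewrite -real_leNgt ?rpredB ?normr_real ?ger0_real//.
rewrite lerBlDr -lerBlDl (le_trans _ (xM n))//.
  rewrite lerBlDl.
  by have := ler_normD (l - x n) (x n); rewrite subrK.
Qed.
End SquareSums.

(** * Uniform bounds on powers *)

(** In the binomial expansion the tail starts at h ^+ 2. Since |h| <= d, each
    |h| ^+ i with i >= 2 is at most (|h| / d) ^+ 2 * d ^+ i, and what is left is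
    bounded by the expansion of (|z| + d) ^+ e. The point is that the constant
    in front does not depend on the exponent. *)
Lemma exprD_remainder (K : numFieldType) (z h : K) (e : nat) (d : K) :
  0 < d -> `|h| <= d ->
  `|(z + h) ^+ e - z ^+ e - e%:R * z ^+ e.-1 * h|
    <= `|h| ^+ 2 / d ^+ 2 * (`|z| + d) ^+ e.
Proof.
move=> d0 hd; case: e => [|e].
  rewrite !expr0 mul0r mul0r subrr subr0 normr0 mulr1.
  by rewrite divr_ge0 ?exprn_ge0 ?(ltW d0).
rewrite [(z + h) ^+ _]exprDn [(`|z| + d) ^+ _]exprDn.
rewrite !big_ord_recl/= !subn0 !expr0 !mulr1 !expr1 bin0 mulr1n bin1.
(* the first two binomial terms cancel against z ^+ e and its derivative *)
rewrite subn1 /= (_ : z ^+ e.+1 + _ - _ - _ = \sum_(i < e)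
    z ^+ (e.+1 - bump 0 (bump 0 i)) * h ^+ (bump 0 (bump 0 i))
      *+ 'C(e.+1, bump 0 (bump 0 i))); last first.
  by rewrite -mulr_natl mulrA; set S := \sum_(i < e) _; ring.
rewrite mulrDr mulrDr addrA (le_trans (ler_norm_sum _ _ _))//.
rewrite -[X in X <= _]add0r lerD//.
  by rewrite addr_ge0// mulr_ge0// ?divr_ge0 ?exprn_ge0 ?mulrn_wge0 ?mulr_ge0
    ?exprn_ge0// ltW.
rewrite mulr_sumr ler_sum// => i _; rewrite /bump /= !add1n.
rewrite normrMn normrM !normrX mulrnAr lerMn2r; apply/orP; right.
rewrite -[i.+2]addn2 !exprD; set k := (e.+1 - _)%N.
have -> : `|h| ^+ 2 / d ^+ 2 * (`|z| ^+ k * (d ^+ i * d ^+ 2))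
    = `|z| ^+ k * (d ^+ i * `|h| ^+ 2) by field; rewrite gt_eqF.
rewrite ler_wpM2l ?exprn_ge0// ler_wpM2r ?exprn_ge0//.
by rewrite lerXn2r ?nnegrE ?normr_ge0 ?(ltW d0).
Qed.

(** e * p ^+ e * d is at most the linear-in-d term of (p + d) ^+ e.+1. *)
Lemma natr_le_expr (K : numFieldType) (p d : K) (e : nat) : 0 <= p -> 0 < d ->
  e%:R * p ^+ e <= (p + d) / d * (p + d) ^+ e.
Proof.
move=> p0 d0.
have pd : 0 <= p + d by rewrite addr_ge0 // ltW.
suff : e%:R * p ^+ e * d <= (p + d) ^+ e.+1.
  by rewrite -ler_pdivlMr// exprS mulrAC.
rewrite exprDn big_ord_recl/= big_ord_recl/= /bump/=.
rewrite !subn0 subn1 /= addn0 bin1 addrC -addrA.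
rewrite (le_trans _ (_ : p ^+ e * d ^+ 1 *+ e.+1 <= _))//.
  rewrite expr1 -mulrA mulr_natl [leRHS]mulrSr lerDl.
  by rewrite mulr_ge0 ?exprn_ge0 ?(ltW d0).
rewrite lerDl addr_ge0//; last by rewrite mulr1n mulr_ge0// exprn_ge0.
by apply: sumr_ge0 => i _; rewrite mulrn_wge0// mulr_ge0// exprn_ge0// ltW.
Qed.
(** The growth of an Euler factor s + e is absorbed by a slightly larger
    radius. *)
Lemma euler_factor_bound (K : numFieldType) (s w p d : K) (e : nat) :
  0 <= p -> 0 < d ->
  `|(s + e%:R) * w * p ^+ e|
    <= (`|s| + (p + d) / d) * `|w * (p + d) ^+ e|.
Proof.
move=> p0 d0; have pd0 : 0 <= p + d by rewrite addr_ge0// ltW.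
rewrite -mulrA !normrM !normrX mulrCA [leRHS]mulrCA ler_wpM2l//.
rewrite (ger0_norm p0) (ger0_norm pd0).
apply: (@le_trans _ _ ((`|s| + e%:R) * p ^+ e)).
  by rewrite ler_wpM2r ?exprn_ge0// (le_trans (ler_normD _ _))// normr_nat.
rewrite !mulrDl lerD// -?mulrDl ?natr_le_expr//.
by rewrite ler_wpM2l// lerXn2r ?nnegrE// lerDl ltW.
Qed.

(** * Differentiation of weighted double power series *)

Section ComplexDerivative.
Context {R : realType}.
Local Notation C := (R[i]^o).

Lemma is_derive_littleo (f : C -> C) (z l : C) :
  (forall eps : C, 0 < eps ->
     \forall h \near (0 : C), `|f (z + h) - f z - l * h| <= eps * `|h|) ->
  is_derive z 1 f l.
Proof.
move=> fl.
have lim_fl : h^-1 *: ((f \o shift z) (h *: 1) - f z) @[h --> (0 : C)^'] --> l.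
  apply/cvgrPdist_le => e e0.
  have fe := fl e e0; near=> h.
  have h0 : h != 0 by near: h; exact: (@nbhs_dnbhs_neq C).
  have : `|f (z + h) - f z - l * h| <= e * `|h|.
    by near: h; exact: nbhs_dnbhs fe.
  rewrite -ler_pdivrMr ?normr_gt0// => /(le_trans _); apply.
  rewrite -normfV -normrM -normrN /= -[h *: 1]/(h * 1) mulr1.
  rewrite -[_ *: _]/(_ * _) (addrC h z) opprB mulrBl mulfK//.
  by rewrite mulrC.
split; first by apply/cvg_ex; exists l.
exact: cvg_lim lim_fl.
Unshelve. all: by end_near. Qed.

End ComplexDerivative.

Section PowerDoubleSeries.
Context {R : realType}.
Local Notation C := (R[i]^o).

Lemma sq_summable_le (v w : nat -> nat -> C) (K : C) :
  (forall m n, `|v m n| <= K * `|w m n|) -> 0 <= K ->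
  sq_summable w -> sq_summable v.
Proof.
move=> vw K0 [M wM]; exists (K * M) => N.
apply: le_trans (ler_wpM2l K0 (wM N)).
rewrite /sq_sum mulr_sumr ler_sum// => m _.
by rewrite mulr_sumr ler_sum.
Qed.

(** Summability at every radius below [rho] rather than at [rho] itself: this
    form survives multiplication of the coefficients by Euler factors. *)
Definition dpower_summable (e : nat -> nat -> nat) (rho : C)
    (u : nat -> nat -> C) : Prop :=
  forall p : C, 0 <= p -> p < rho ->
    sq_summable (fun m n => u m n * p ^+ e m n).

(** The weight [e] is m + n on the line (z, z * y) and m on the line (z, y), so
    that both families of identities concern the same kind of series. *)
Definition dpower_series (e : nat -> nat -> nat) (u : nat -> nat -> C)
    (z : C) : C :=
  limn (sq_sum (fun m n => u m n * z ^+ e m n) : nat -> C).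

Variables (e : nat -> nat -> nat) (rho : C).

Lemma dpower_summable_euler (u : nat -> nat -> C) (s : C) :
  dpower_summable e rho u ->
  dpower_summable e rho (fun m n => (s + (e m n)%:R) * u m n).
Proof.
move=> uc p p0 prho.
pose d := (rho - p) / 2.
have d0 : 0 < d by rewrite divr_gt0// subr_gt0.
have pd0 : 0 <= p + d by rewrite addr_ge0// ltW.
have pdrho : p + d < rho.
  by rewrite /d -ltrBrDl gtr_pMr ?subr_gt0// invf_lt1// ltr1n.
apply: sq_summable_le (uc _ pd0 pdrho); last first.
  by apply: (addr_ge0 (normr_ge0 s)); exact: (divr_ge0 pd0 (ltW d0)).
by move=> m n; exact: euler_factor_bound.
Qed.

Lemma dpower_series_cvg (u : nat -> nat -> C) (z : C) :
  dpower_summable e rho u -> `|z| < rho ->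
  cvgn (sq_sum (fun m n => u m n * z ^+ e m n) : nat -> C).
Proof.
move=> uc zrho; apply: sq_summable_cvg.
apply: sq_summable_le (uc _ (normr_ge0 z) zrho); last exact: ler01.
by move=> m n; rewrite mul1r !normrM !normrX normr_id.
Qed.

(** Termwise differentiation. The first-order remainder of each monomial is
    bounded by [exprD_remainder], hence the remainder of every partial sum is at
    most |h| ^+ 2 / d ^+ 2 times a bound for the absolute sums at radius
    |z| + d, and this passes to the limit. The derivative is written with the
    Euler operator z d/dz, which keeps the exponents of the series. *)
Lemma is_derive_dpower_series (u : nat -> nat -> C) (z : C) :
  dpower_summable e rho u -> `|z| < rho -> z != 0 ->
  is_derive z 1 (dpower_series e u)
    (dpower_series e (fun m n => (e m n)%:R * u m n) z / z).
Proof.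
move=> uc zrho z0; apply: is_derive_littleo => eps eps0.
pose d := (rho - `|z|) / 2.
have d0 : 0 < d by rewrite divr_gt0// subr_gt0.
have pd0 : 0 <= `|z| + d by rewrite addr_ge0// ltW.
have pdrho : `|z| + d < rho.
  by rewrite /d -ltrBrDl gtr_pMr ?subr_gt0// invf_lt1// ltr1n.
have [M uM] := uc _ pd0 pdrho.
have M0 : 0 <= M by apply: le_trans (uM 0%N); rewrite /sq_sum big_ord0.
near=> h.
have hd : `|h| <= d by near: h; exact: (@nbhs0_le _ C).
have heps : `|h| <= eps * (d ^+ 2 / (M + 1)).
  near: h; apply: (@nbhs0_le _ C).
  by rewrite mulr_gt0 ?divr_gt0 ?exprn_gt0 ?ltr_wpDl.
have zhrho : `|z + h| < rho.
  by rewrite (le_lt_trans _ pdrho)// (le_trans (ler_normD _ _))// lerD2l.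
apply: (@le_trans _ _ (`|h| ^+ 2 / d ^+ 2 * M)); last first.
  rewrite expr2 -mulrA -mulrA [leRHS]mulrC ler_wpM2l//.
  rewrite (le_trans (ler_wpM2r _ heps)) ?mulr_ge0 ?invr_ge0 ?exprn_ge0
    ?(ltW d0)//.
  have -> : eps * (d ^+ 2 / (M + 1)) * (d ^- 2 * M) = eps * (M / (M + 1)).
    by field; rewrite (gt_eqF d0) (gt_eqF (ltr_wpDl M0 ltr01)).
  by rewrite ger_pMr// ler_pdivrMr ?ltr_wpDl// mul1r lerDl.
have cu' : dpower_summable e rho (fun m n => (e m n)%:R * u m n).
  have := dpower_summable_euler u 0 uc.
  by under eq_fun do under eq_fun do rewrite add0r.
have c1 := dpower_series_cvg u (z + h) uc zhrho.
have c2 := dpower_series_cvg u z uc zrho.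
have c3 := dpower_series_cvg _ z cu' zrho.
apply: limn_norm_le.
  apply: cvgB; first exact: cvgB c1 c2.
  by apply: cvgMr_tmp; apply: cvgMr_tmp c3.
move=> N /=; apply: le_trans (ler_wpM2l _ (uM N)); last first.
  by rewrite divr_ge0 ?exprn_ge0 ?(ltW d0).
rewrite !fctE /sq_sum -sumrB !mulr_suml -sumrB mulr_sumr.
rewrite (le_trans (ler_norm_sum _ _ _))// ler_sum// => m _.
rewrite -sumrB !mulr_suml -sumrB mulr_sumr.
rewrite (le_trans (ler_norm_sum _ _ _))// ler_sum// => n _.
rewrite (_ : _ - _ = u m n * ((z + h) ^+ e m n - z ^+ e m n
    - (e m n)%:R * z ^+ (e m n).-1 * h)); last first.
  case: (e m n) => [|k] /=; first by rewrite !mul0r !subr0 mulrBr.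
  rewrite [z ^+ _]exprS; move: (z ^+ k) ((z + h) ^+ _) (_%:R) => *.
  by field.
rewrite !normrM [leRHS]mulrCA ler_wpM2l// normrX (ger0_norm pd0).
exact: exprD_remainder.
Unshelve. all: by end_near. Qed.

End PowerDoubleSeries.

(** * The complex exponential and powers along a branch of the logarithm *)

Lemma is_derive_chain (K : numFieldType) (f g : K -> K) (x df dg : K) :
  is_derive x 1 f df -> is_derive (f x) 1 g dg ->
  is_derive x 1 (g \o f) (dg * df).
Proof.
move=> [fd <-] [gd <-]; rewrite -!derive1E.
have fd' := (derivable1_diffP _ _).1 fd.
have gd' := (derivable1_diffP _ _).1 gd.
have gf : differentiable (g \o f) x by exact: differentiable_comp.
split; first exact/derivable1_diffP.
rewrite -derive1E derive1E'// diff_comp// !derive1E' //=.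
rewrite -[X in 'd  _ _ X = _]mulr1.
by rewrite [LHS]linearZ mulrC.
Qed.

Section ComplexPower.
Context {R : realType}.
Local Notation C := (R[i]^o).

Lemma real_derive_littleo (f : R -> R) (l : R) : is_derive (0 : R) 1 f l ->
  forall eps : R, 0 < eps ->
    \forall h \near (0 : R), `|f h - f 0 - l * h| <= eps * `|h|.
Proof.
move=> [fd fl] eps eps0.
have : h^-1 *: ((f \o shift 0) (h *: 1) - f 0) @[h --> (0 : R)^'] --> l.
  by rewrite -fl; exact: fd.
move=> /cvgrPdist_le /(_ eps eps0) fe.
have {fe} : \forall h \near (0 : R), h != 0 ->
    `|l - h^-1 *: ((f \o shift 0) (h *: 1) - f 0)| <= eps by exact: fe.
apply: filterS => h; have [->|h0 /(_ isT)] := eqVneq h 0.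
  by rewrite subrr mulr0 subr0 !normr0 mulr0.
rewrite /= addr0 -[h *: 1]/(h * 1) mulr1 -[_ *: _]/(_ * _) => fe.
rewrite -ler_pdivrMr ?normr_gt0// -normfV -normrM -normrN.
by rewrite mulrBl mulfK// opprB mulrC.
Qed.

Lemma cexpD (x y : C) : cexp (x + y) = cexp x * cexp y.
Proof.
case: x y => [p q] [p' q'].
apply/eqP; rewrite eq_complex/= expRD sinD cosD.
by apply/andP; split; apply/eqP; ring.
Qed.

Lemma cexp0 : cexp (0 : C) = 1.
Proof. by rewrite /cexp/= expR0 cos0 sin0 mulr1 mulr0. Qed.

Lemma cexp_neq0 (x : C) : cexp x != 0.
Proof.
have : cexp x * cexp (- x) != 0 by rewrite -cexpD subrr cexp0 oner_neq0.
by rewrite mulf_eq0 negb_or => /andP[].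
Qed.

(** With h = p + i q, the real part of the remainder is
    (e^p - 1 - p) + e^p (cos q - 1) and the imaginary part is
    e^p (sin q - q) + (e^p - 1) q. As e^p <= 2, the contributions add up to six
    times the bound r / 6. *)
Lemma cexp_remainder_le (h : C) (r : R) : 0 <= r ->
  `|expR (complex.Re h) - expR 0 - expR 0 * complex.Re h|
    <= r / 6 * `|complex.Re h| ->
  `|expR 0 - expR (complex.Re h)| <= r / 6 ->
  `|expR 0 - expR (complex.Re h)| <= 1 ->
  `|sin (complex.Im h) - sin 0 - cos 0 * complex.Im h|
    <= r / 6 * `|complex.Im h| ->
  `|cos (complex.Im h) - cos 0 - - sin 0 * complex.Im h|
    <= r / 6 * `|complex.Im h| ->
  `|cexp h - 1 - h| <= r%:C * `|h|.
Proof.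
move=> r0; rewrite expR0 sin0 cos0 subr0 oppr0 mul0r subr0 !mul1r.
have nE : `|h| = (complex.Re `|h|)%:C by rewrite RRe_real// normr_real.
have Rn : `|complex.Re h| <= complex.Re `|h| by rewrite -lecR -nE normc_ge_Re.
have In : `|complex.Im h| <= complex.Re `|h| by rewrite -lecR -nE normc_ge_Im.
move=> P1 P4 P5 Q2 Q3; apply: le_trans (norm_complex_le _) _.
rewrite nE -rmorphM lecR {nE}.
move: (complex.Re `|h|) Rn In => n; case: h P1 P4 P5 Q2 Q3 => [p q] /=.
set E := expR p; set c := cos q; set s := sin q.
move=> P1 P4 P5 Q2 Q3 pn qn.
have E2 : `|E| <= 2.
  by rewrite ler_norml; move: P5; rewrite ler_norml; lra.
have r60 : 0 <= r / 6 by rewrite divr_ge0.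
have B1 : `|E * c - 1 - p| <= r / 6 * n + 2 * (r / 6 * n).
  have -> : E * c - 1 - p = (E - 1 - p) + E * (c - 1) by ring.
  rewrite (le_trans (ler_normD _ _))// lerD//.
    by rewrite (le_trans P1)// ler_wpM2l.
  by rewrite normrM ler_pM// (le_trans Q3)// ler_wpM2l.
have B2 : `|E * s - q| <= 2 * (r / 6 * n) + r / 6 * n.
  have -> : E * s - q = E * (s - q) - (1 - E) * q by ring.
  rewrite (le_trans (ler_normB _ _))// !normrM lerD// ler_pM//.
  by rewrite (le_trans Q2)// ler_wpM2l.
rewrite !subr0 in B1 B2 *; lra.
Qed.

Lemma cexp_littleo (eps : C) : 0 < eps ->
  \forall h \near (0 : C), `|cexp h - 1 - h| <= eps * `|h|.
Proof.
move=> eps0.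
have eE : eps = (complex.Re eps)%:C by rewrite RRe_real// gtr0_real.
set r := complex.Re eps in eE; rewrite eE ltcR in eps0; rewrite {}eE.
have r0 : 0 < r / 6 by rewrite divr_gt0.
have e1 := real_derive_littleo _ _ (is_derive_expR (0 : R)) _ r0.
have e2 := real_derive_littleo _ _ (is_derive_sin (0 : R)) _ r0.
have e3 := real_derive_littleo _ _ (is_derive_cos (0 : R)) _ r0.
have e4 : \forall h \near (0 : R), `|expR 0 - expR h| <= r / 6.
  exact: (cvgrPdist_le _ _).1 (@continuous_expR R 0) _ r0.
have e5 : \forall h \near (0 : R), `|expR 0 - expR h| <= 1.
  exact: (cvgrPdist_le _ _).1 (@continuous_expR R 0) _ ltr01.
have [d /= d0 dP] := (nbhs_normP _ _).1
  (filterI e1 (filterI e2 (filterI e3 (filterI e4 e5)))).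
have dC : 0 < d%:C by rewrite ltcR.
near=> h.
have hd : `|h| < d%:C by near: h; exact: (@nbhs0_lt _ C).
have Rd : `|complex.Re h| < d by rewrite -ltcR (le_lt_trans (normc_ge_Re h)).
have Id : `|complex.Im h| < d by rewrite -ltcR (le_lt_trans (normc_ge_Im h)).
have ballE (x : R) : `|x| < d -> `|0 - x| < d by rewrite sub0r normrN.
have [P1 [_ [_ [P4 P5]]]] := dP _ (ballE _ Rd).
have [_ [Q2 [Q3 _]]] := dP _ (ballE _ Id).
by apply: cexp_remainder_le; [exact: ltW|..].
Unshelve. all: by end_near. Qed.
End ComplexPower.

Section ComplexPowerDerivative.
Context {R : realType}.
Local Notation C := (R[i]^o).

Lemma is_derive_cexp (z : C) : is_derive z 1 (@cexp R) (cexp z).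
Proof.
apply: is_derive_littleo => eps eps0.
have cz0 : 0 < `|cexp z| by rewrite normr_gt0 cexp_neq0.
near=> h.
rewrite cexpD (_ : _ - _ - _ = cexp z * (cexp h - 1 - h)); last by ring.
rewrite normrM mulrC -ler_pdivlMr// mulrAC.
by near: h; apply: cexp_littleo; rewrite divr_gt0.
Unshelve. all: by end_near. Qed.

Lemma log_branch_neq0 (U : set C) (L : C -> C) (z : C) :
  log_branch U L -> U z -> z != 0.
Proof. by move=> [_ _ UL] /UL <-; exact: cexp_neq0. Qed.

(** A continuous right inverse of an exponential is differentiable: the
    increment k of L at z satisfies cexp k = 1 + h / z, and k tends to 0, so that
    |h / z - k| <= eps |k|. Taking eps = 1/2 first gives |k| <= 2 |h / z|, which
    turns a bound relative to |k| into one relative to |h|. *)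
Lemma is_derive_log_branch (U : set C) (L : C -> C) (z : C) :
  log_branch U L -> U z -> is_derive z 1 L z^-1.
Proof.
move=> UL Uz; have z0 := log_branch_neq0 _ _ _ UL Uz.
have [Uo Lc cL] := UL.
apply: is_derive_littleo => eps eps0.
have nz0 : 0 < `|z| by rewrite normr_gt0.
pose k h := L (z + h) - L z.
have k_cvg0 : k h @[h --> (0 : C)] --> (0 : C).
  apply: (cvgrPdist_le (FF := nbhs_filter (0 : C)) k 0).2 => e e0.
  have /cvgrPdist_le /(_ e e0) Le := Lc z Uz.
  near=> h; rewrite sub0r normrN distrC.
  by near: h; exact: (nbhs0P _ _).1 Le.
have near_k (e : C) : 0 < e ->
    \forall h \near (0 : C), `|cexp (k h) - 1 - k h| <= e * `|k h|.
  by move=> e0; exact: (k_cvg0 _ (cexp_littleo _ e0)).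
have nearU : \forall h \near (0 : C), U (z + h).
  by apply: (nbhs0P _ _).1; exact: Uo.
near=> h.
(* the branch property turns the increment k of L into h *)
have cexp_k : cexp (k h) = 1 + z^-1 * h.
  have Uzh : U (z + h) by near: h.
  have := cL _ Uzh.
  rewrite -{1}(subrK (L z) (L (z + h))) cexpD (cL _ Uz) -/(k h) => kz.
  by apply: (mulIf z0); rewrite kz; field.
have half : `|cexp (k h) - 1 - k h| <= 2^-1 * `|k h| by near: h; apply: near_k.
have small : `|cexp (k h) - 1 - k h| <= (eps * `|z| / 2) * `|k h|.
  by near: h; apply: near_k; rewrite divr_gt0// mulr_gt0.
move: half small; rewrite cexp_k -/(k h).
rewrite [X in `|X|](_ : _ = z^-1 * h - k h); last by ring.
rewrite distrC => half small.
have kh : `|k h| <= 2 * (`|h| / `|z|).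
  have : `|k h| <= `|k h - z^-1 * h| + `|z^-1 * h|.
    by rewrite -{1}(subrK (z^-1 * h) (k h)) ler_normD.
  move=> /le_trans /(_ (lerD half (lexx _))).
  rewrite normrM normfV [_^-1 * `|h|]mulrC -lerBlDl.
  rewrite (_ : `|k h| - _ = `|k h| / 2); last by field.
  by rewrite ler_pdivrMr// [_ * 2]mulrC.
apply: (le_trans small); apply: (le_trans (ler_wpM2l _ kh)).
  by rewrite divr_ge0// mulr_ge0// ltW.
rewrite le_eqVlt; apply/orP; left; apply/eqP; field.
by rewrite gt_eqF.
Unshelve. all: by end_near. Qed.

Lemma cpow_succ (U : set C) (L : C -> C) (s z : C) :
  log_branch U L -> U z -> cpow L s z = cpow L (s - 1) z * z.
Proof.
move=> [_ _ UL] Uz; rewrite /cpow -{3}(UL z Uz) -cexpD; congr cexp; ring.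
Qed.

Lemma is_derive_cpow (U : set C) (L : C -> C) (s z : C) :
  log_branch U L -> U z ->
  is_derive z 1 (cpow L s) (s * cpow L (s - 1) z).
Proof.
move=> UL Uz; have z0 := log_branch_neq0 _ _ _ UL Uz.
have Lz := is_derive_log_branch _ _ _ UL Uz.
have sLz : is_derive z 1 (fun w => s * L w : C) (s / z).
  exact: (@is_deriveZ C C C L s z 1 z^-1 Lz).
have -> : s * cpow L (s - 1) z = cpow L s z * (s / z).
  by rewrite (cpow_succ _ _ s _ UL Uz); field.
exact: is_derive_chain sLz (is_derive_cexp (s * L z)).
Qed.
End ComplexPowerDerivative.

(** * Iterated derivatives of a power times a series *)

Section EulerOperator.
Context {R : realType}.
Local Notation C := (R[i]^o).
Variables (e : nat -> nat -> nat) (rho : C) (U : set C) (L : C -> C).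
Context (UL : log_branch U L).

Lemma dpower_series_euler (u : nat -> nat -> C) (s z : C) :
  dpower_summable e rho u -> `|z| < rho ->
  dpower_series e (fun m n => (s + (e m n)%:R) * u m n) z
    = s * dpower_series e u z
      + dpower_series e (fun m n => (e m n)%:R * u m n) z.
Proof.
move=> uc zrho.
have cu' : dpower_summable e rho (fun m n => (e m n)%:R * u m n).
  have := dpower_summable_euler e rho u 0 uc.
  by under eq_fun do under eq_fun do rewrite add0r.
have c1 := dpower_series_cvg e rho u z uc zrho.
have c2 := dpower_series_cvg e rho _ z cu' zrho.
have lim_sum : (s * sq_sum (fun m n => u m n * z ^+ e m n) N
    + sq_sum (fun m n => (e m n)%:R * u m n * z ^+ e m n) N : C) @[N --> \oo]
    --> (s * dpower_series e u z
         + dpower_series e (fun m n => (e m n)%:R * u m n) z : C).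
  by apply: cvgD c2; apply: cvgMl_tmp.
rewrite -(cvg_lim (@norm_hausdorff C C) lim_sum); congr (limn _).
apply/funext => N; rewrite /sq_sum mulr_sumr -big_split/=.
apply: eq_bigr => m _; rewrite mulr_sumr -big_split/=.
by apply: eq_bigr => n _; rewrite mulrDl mulrDl mulrA.
Qed.

(** Formally, d/dz sends z ^ (s + e) to (s + e) z ^ (s - 1 + e): differentiation
    lowers the exponent of the power by one and multiplies the coefficients by
    the Euler factor s + e. *)
Lemma is_derive_cpow_dpower_series (u : nat -> nat -> C) (s z : C) :
  dpower_summable e rho u -> U z -> `|z| < rho ->
  is_derive z 1 (fun w => cpow L s w * dpower_series e u w : C)
    (cpow L (s - 1) z
     * dpower_series e (fun m n => (s + (e m n)%:R) * u m n) z).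
Proof.
move=> uc Uz zrho.
have z0 := log_branch_neq0 _ _ _ UL Uz.
have dp := is_derive_dpower_series e rho u z uc zrho z0.
have dc := is_derive_cpow U L s z UL Uz.
have := is_deriveM dc dp.
rewrite dpower_series_euler// (cpow_succ U L s z UL Uz).
congr (is_derive _ _ _ _).
by rewrite /GRing.scale/=; field.
Qed.

Lemma near_power_domain (z : C) : U z -> `|z| < rho ->
  \forall w \near z, U w /\ `|w| < rho.
Proof.
move=> Uz zrho; near=> w; split.
  by near: w; have [Uo _ _] := UL; exact: Uo.
have : `|z - w| < rho - `|z|.
  near: w.
  apply: ((cvgrPdist_lt (FF := nbhs_filter (z : C)) id z).1 (fun A => id)).
  by rewrite subr_gt0.
rewrite ltrBrDr => /(le_lt_trans _); apply.
by rewrite distrC -{1}(subrK z w) ler_normD.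
Unshelve. all: by end_near. Qed.

Definition falling_coef (s : C) (u : nat -> nat -> C) (k : nat)
    (m n : nat) : C :=
  (\prod_(j < k) (s - j%:R + (e m n)%:R)) * u m n.

Lemma falling_coefS (s : C) (u : nat -> nat -> C) (k : nat) :
  falling_coef s u k.+1
    = fun m n => (s - k%:R + (e m n)%:R) * falling_coef s u k m n.
Proof.
apply/funext => m; apply/funext => n.
by rewrite /falling_coef big_ord_recr/= mulrAC mulrC.
Qed.

Lemma falling_coef0 (s : C) (u : nat -> nat -> C) : falling_coef s u 0 = u.
Proof.
by apply/funext => m; apply/funext => n; rewrite /falling_coef big_ord0 mul1r.
Qed.

Lemma falling_coef_summable (s : C) (u : nat -> nat -> C) (k : nat) :
  dpower_summable e rho u -> dpower_summable e rho (falling_coef s u k).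
Proof.
move=> uc; elim: k => [|k IHk]; first by rewrite falling_coef0.
by rewrite falling_coefS; exact: dpower_summable_euler.
Qed.

Lemma derive1n_cpow_dpower_series (u : nat -> nat -> C) (s : C) (k : nat) :
  dpower_summable e rho u ->
  forall z, U z -> `|z| < rho ->
  derive1n k (fun w => cpow L s w * dpower_series e u w : C) z
    = cpow L (s - k%:R) z * dpower_series e (falling_coef s u k) z.
Proof.
move=> uc; elim: k => [|k IHk] z Uz zrho.
  by rewrite derive1n0 subr0 falling_coef0.
rewrite derive1nS derive1E.
have near_IH : \forall w \near z,
    derive1n k (fun w => cpow L s w * dpower_series e u w : C) w
      = cpow L (s - k%:R) w * dpower_series e (falling_coef s u k) w.
  by apply: filterS (near_power_domain z Uz zrho) => w [? ?]; exact: IHk.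
rewrite (near_eq_derive _ near_IH).
have dk := is_derive_cpow_dpower_series _ (s - k%:R) z
  (falling_coef_summable s u k uc) Uz zrho.
rewrite derive_val -falling_coefS; congr (cpow L _ z * _).
by rewrite -natr1 opprD addrA.
Qed.

(** The six identities are instances of this one: they differ in the exponent
    [s], the weight and the resulting falling product. *)
Lemma is_nth_deriv_cpow_dpower_series (u : nat -> nat -> C) (s : C) (r : nat)
    (z : C) :
  dpower_summable e rho u -> U z -> `|z| < rho ->
  is_nth_deriv r (fun w => cpow L s w * dpower_series e u w : C) z
    (cpow L (s - r%:R) z * dpower_series e (falling_coef s u r) z).
Proof.
move=> uc Uz zrho; split; last exact: derive1n_cpow_dpower_series.
move=> k _; apply: filterS (near_power_domain z Uz zrho) => w [Uw wrho].
have near_k : \forall w' \near w,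
    cpow L (s - k%:R) w' * dpower_series e (falling_coef s u k) w'
    = derive1n k (fun w => cpow L s w * dpower_series e u w : C) w'.
  apply: filterS (near_power_domain w Uw wrho) => w' [? ?].
  by rewrite derive1n_cpow_dpower_series.
apply: near_eq_derivable near_k _.
have dk := is_derive_cpow_dpower_series _ (s - k%:R) w
  (falling_coef_summable s u k uc) Uw wrho.
exact: ex_derive.
Qed.
End EulerOperator.

(** * Shifted factorials and the discrete Appell function *)

Section AppellFunction.
Context {R : realType}.
Local Notation C := (R[i]^o).

Lemma pochD (a : C) (m n : nat) :
  poch a (m + n) = poch a m * poch (a + m%:R) n.
Proof.
rewrite /poch big_split_ord/=; congr (_ * _); apply: eq_bigr => i _.
by rewrite natrD addrA.
Qed.

Lemma poch_rev (a : C) (r : nat) :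
  \prod_(j < r) (a + r%:R - 1 - j%:R) = poch a r.
Proof.
rewrite /poch (reindex_inj rev_ord_inj)/=; apply: eq_bigr => i _.
by rewrite natrB// -natr1; ring.
Qed.

Lemma poch_reflect (c : C) (r : nat) :
  (-1) ^+ r * poch (1 - c) r = poch (c - r%:R) r.
Proof.
have -> : (-1) ^+ r = \prod_(j < r) (-1) :> C by rewrite prodr_const card_ord.
rewrite -poch_rev /poch -big_split; apply: eq_bigr => j _ /=; ring.
Qed.

Lemma poch_neq0 (c : C) (n : nat) : admissible_lower c -> poch c n != 0.
Proof.
move=> ac; apply/prodf_neq0 => i _; apply/eqP => ci.
have /negP := ac i; apply; apply/eqP.
have -> : c = - i%:R by apply/eqP; rewrite -addr_eq0 ci.
have -> : (i%:R : C) = (i%:R : R)%:C by rewrite rmorph_nat.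
by [].
Qed.

(** For c = 0 the family v may diverge, and both sides are 0. *)
Lemma limn_sq_sum_scale (c : C) (v : nat -> nat -> C) :
  cvgn (sq_sum (fun m n => c * v m n) : nat -> C) ->
  limn (sq_sum (fun m n => c * v m n) : nat -> C)
    = c * limn (sq_sum v : nat -> C).
Proof.
have sumE : (sq_sum (fun m n => c * v m n) : nat -> C)
    = (fun N => c * sq_sum v N).
  apply/funext => N; rewrite /sq_sum mulr_sumr; apply: eq_bigr => m _.
  by rewrite mulr_sumr.
have [->|c0] := eqVneq c 0.
  move=> _; rewrite mul0r; apply: (cvg_lim (@norm_hausdorff C C)).
  rewrite (_ : sq_sum _ = fun=> 0); first exact: cvg_cst.
  apply/funext => N; rewrite /sq_sum big1// => m _.
  by rewrite big1// => n _; rewrite mul0r.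
move=> cv; apply: (mulfI (invr_neq0 c0)); rewrite mulKf//.
have lim_v : c^-1 * sq_sum (fun m n => c * v m n) N @[N --> \oo]
    --> c^-1 * limn (sq_sum (fun m n => c * v m n) : nat -> C).
  exact: cvgMl_tmp.
rewrite -(cvg_lim (@norm_hausdorff C C) lim_v); congr (limn _).
by apply/funext => N; rewrite sumE mulKf.
Qed.

(** Isolates the two parameters that the derivatives shift. *)
Lemma F41_term_factor (a c2 t1 t2 : C) (k1 k2 : nat) (x y : C) (m n : nat) :
  exists w : C, forall b c1 : C,
    F41_term a b c1 c2 t1 t2 k1 k2 x y m n = poch b (m + n) / poch c1 m * w.
Proof.
exists (poch a (m + n)
    * (-1) ^+ (m * k1) * poch (- t1) (m * k1)
    * (-1) ^+ (n * k2) * poch (- t2) (n * k2)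
    / (poch c2 n * m`!%:R * n`!%:R) * x ^+ m * y ^+ n) => b c1.
rewrite /F41_term -!(mulrA (poch c1 m)) (invfM (poch c1 m)).
by ring.
Qed.

Lemma F41_termE (a b c1 c2 t1 t2 : C) (k1 k2 : nat) (x y : C) (m n : nat) :
  F41_term a b c1 c2 t1 t2 k1 k2 x y m n
    = F41_term a b c1 c2 t1 t2 k1 k2 1 y m n * x ^+ m.
Proof. by rewrite /F41_term expr1n mulr1 mulrAC. Qed.

Lemma F41_term_diag (a b c1 c2 t1 t2 : C) (k1 k2 : nat) (z y : C) (m n : nat) :
  F41_term a b c1 c2 t1 t2 k1 k2 z (z * y) m n
    = F41_term a b c1 c2 t1 t2 k1 k2 1 y m n * z ^+ (m + n).
Proof. by rewrite /F41_term expr1n mulr1 exprMn exprD; ring. Qed.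

Lemma sqrtC_norm_lt (p q : C) : 0 <= q -> (sqrtC `|p| < q) = (`|p| < q ^+ 2).
Proof.
move=> q0; rewrite -{1}(sqrCK q0) ltr_sqrtC// nnegrE ?exprn_ge0//.
Qed.

(** On the line (p, p * y) the region is a disc, because
    sqrt |p y| = sqrt |p| sqrt |y|. *)
Lemma F41_region_diag (p y : C) :
  F41_region p (p * y) <-> `|p| < (1 + sqrtC `|y|)^-1 ^+ 2.
Proof.
have t0 : 0 < 1 + sqrtC `|y| by rewrite ltr_wpDr// sqrtC_ge0.
rewrite /F41_region -sqrtC_norm_lt; last by rewrite invr_ge0 ltW.
rewrite normrM rootCMl// -{1}(mulr1 (sqrtC `|p|)) -mulrDr.
by rewrite -ltr_pdivlMr// mul1r.
Qed.

Lemma F41_region_left (p y : C) : sqrtC `|y| < 1 ->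
  F41_region p y <-> `|p| < (1 - sqrtC `|y|) ^+ 2.
Proof.
move=> y1; rewrite /F41_region -sqrtC_norm_lt ?subr_ge0 1?ltW//.
by rewrite ltrBrDr.
Qed.

(** Here the falling product is (b + m + n)_r, and
    (b)_(m+n) (b + m + n)_r = (b)_(m+n+r) = (b)_r (b + r)_(m+n). *)
Lemma F41_diag_derivative (a b c1 c2 t1 t2 : C) (k1 k2 r : nat)
    (U : set C) (L : C -> C) (x y : C) :
  F41_abs_cvg a b c1 c2 t1 t2 k1 k2 -> log_branch U L ->
  U x -> F41_region x (x * y) ->
  is_nth_deriv r
    (fun z => cpow L (b + r%:R - 1) z
              * F41 a b c1 c2 t1 t2 k1 k2 z (z * y)) x
    (cpow L (b - 1) x * poch b r
     * F41 a (b + r%:R) c1 c2 t1 t2 k1 k2 x (x * y)).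
Proof.
move=> Fc UL Ux /F41_region_diag xrho.
set rho := _ ^+ 2 in xrho.
pose u := F41_term a b c1 c2 t1 t2 k1 k2 1 y.
have uc : dpower_summable addn rho u.
  move=> p p0 prho; apply: cvgn_sq_summable.
  have pC : F41_region p (p * y) by apply/F41_region_diag; rewrite ger0_norm.
  under eq_fun do under eq_fun do rewrite -F41_term_diag.
  exact: Fc pC.
have FE z : F41 a b c1 c2 t1 t2 k1 k2 z (z * y) = dpower_series addn u z.
  rewrite /F41 /dpower_series.
  by under eq_fun do under eq_bigr do under eq_bigr do rewrite F41_term_diag.
rewrite (_ : (fun z => _)
    = (fun z => cpow L (b + r%:R - 1) z * dpower_series addn u z)); last first.
  by apply/funext => z; rewrite FE.
have -> : cpow L (b - 1) x * poch b r
      * F41 a (b + r%:R) c1 c2 t1 t2 k1 k2 x (x * y)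
    = cpow L (b + r%:R - 1 - r%:R) x
      * dpower_series addn (falling_coef addn (b + r%:R - 1) u r) x;
  last exact: (is_nth_deriv_cpow_dpower_series addn rho U L UL u _ r x uc Ux
    xrho).
have cf := dpower_series_cvg _ _ _ _
  (falling_coef_summable addn rho (b + r%:R - 1) u r uc) xrho.
pose v m n := F41_term a (b + r%:R) c1 c2 t1 t2 k1 k2 x (x * y) m n.
have fE : (fun m n => falling_coef addn (b + r%:R - 1) u r m n * x ^+ (m + n))
    = (fun m n => poch b r * v m n).
  apply/funext => m; apply/funext => n; rewrite /v F41_term_diag mulrA.
  congr (_ * _); rewrite /falling_coef.
  have -> : \prod_(j < r) (b + r%:R - 1 - j%:R + (m + n)%:R)
      = poch (b + (m + n)%:R) r.
    by rewrite -poch_rev; apply: eq_bigr => j _; ring.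
  have pE : poch b (m + n) * poch (b + (m + n)%:R) r
      = poch b r * poch (b + r%:R) (m + n) by rewrite -!pochD addnC.
  have [w wE] := F41_term_factor a c2 t1 t2 k1 k2 1 y m n.
  rewrite /u !wE.
  have -> : poch (b + (m + n)%:R) r * (poch b (m + n) / poch c1 m * w)
      = (poch b (m + n) * poch (b + (m + n)%:R) r) / poch c1 m * w by ring.
  by rewrite pE; ring.
have FS : dpower_series addn (falling_coef addn (b + r%:R - 1) u r) x
    = poch b r * F41 a (b + r%:R) c1 c2 t1 t2 k1 k2 x (x * y).
  by rewrite /dpower_series fE; rewrite fE in cf; exact: limn_sq_sum_scale.
by rewrite FS mulrA (_ : b + _ - _ - _ = b - 1)//; ring.
Qed.

(** Here the falling product is (c1 - r + m)_r. Splitting (c1 - r)_(m+r) in two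
    ways gives (c1 - r)_m (c1 - r + m)_r = (c1 - r)_r (c1)_m, which trades the
    denominator (c1)_m for (c1 - r)_m. *)
Lemma F41_left_derivative (a b c1 c2 t1 t2 : C) (k1 k2 r : nat)
    (U : set C) (L : C -> C) (x y : C) :
  admissible_lower c1 -> admissible_lower (c1 - r%:R) ->
  F41_abs_cvg a b c1 c2 t1 t2 k1 k2 -> log_branch U L ->
  U x -> F41_region x y ->
  is_nth_deriv r
    (fun z => cpow L (c1 - 1) z * F41 a b c1 c2 t1 t2 k1 k2 z y) x
    ((-1) ^+ r * poch (1 - c1) r * cpow L (c1 - r%:R - 1) x
     * F41 a b (c1 - r%:R) c2 t1 t2 k1 k2 x y).
Proof.
move=> ac1 acr Fc UL Ux xy.
have y1 : sqrtC `|y| < 1.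
  by apply: le_lt_trans xy; rewrite lerDr sqrtC_ge0.
have xrho := (F41_region_left x y y1).1 xy.
set rho := _ ^+ 2 in xrho.
pose u := F41_term a b c1 c2 t1 t2 k1 k2 1 y.
pose e (m n : nat) := m.
have uc : dpower_summable e rho u.
  move=> p p0 prho; apply: cvgn_sq_summable.
  have pC : F41_region p y by apply/(F41_region_left _ _ y1); rewrite ger0_norm.
  under eq_fun do under eq_fun do rewrite -F41_termE.
  exact: Fc pC.
have FE z : F41 a b c1 c2 t1 t2 k1 k2 z y = dpower_series e u z.
  rewrite /F41 /dpower_series.
  by under eq_fun do under eq_bigr do under eq_bigr do rewrite F41_termE.
rewrite (_ : (fun z => _)
    = (fun z => cpow L (c1 - 1) z * dpower_series e u z)); last first.
  by apply/funext => z; rewrite FE.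
have -> : (-1) ^+ r * poch (1 - c1) r * cpow L (c1 - r%:R - 1) x
      * F41 a b (c1 - r%:R) c2 t1 t2 k1 k2 x y
    = cpow L (c1 - 1 - r%:R) x
      * dpower_series e (falling_coef e (c1 - 1) u r) x;
  last exact: (is_nth_deriv_cpow_dpower_series e rho U L UL u _ r x uc Ux xrho).
have cf := dpower_series_cvg _ _ _ _
  (falling_coef_summable e rho (c1 - 1) u r uc) xrho.
pose v m n := F41_term a b (c1 - r%:R) c2 t1 t2 k1 k2 x y m n.
have fE : (fun m n => falling_coef e (c1 - 1) u r m n * x ^+ e m n)
    = (fun m n => poch (c1 - r%:R) r * v m n).
  apply/funext => m; apply/funext => n; rewrite /v F41_termE mulrA.
  congr (_ * _); rewrite /falling_coef /e.
  have -> : \prod_(j < r) (c1 - 1 - j%:R + m%:R) = poch (c1 - r%:R + m%:R) r.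
    by rewrite -poch_rev; apply: eq_bigr => j _; ring.
  have pE : poch (c1 - r%:R) m * poch (c1 - r%:R + m%:R) r
      = poch (c1 - r%:R) r * poch c1 m by rewrite -pochD addnC pochD subrK.
  have c1m := poch_neq0 _ m ac1; have crm := poch_neq0 _ m acr.
  have [w wE] := F41_term_factor a c2 t1 t2 k1 k2 1 y m n.
  have -> : poch (c1 - r%:R + m%:R) r
      = poch (c1 - r%:R) r * poch c1 m / poch (c1 - r%:R) m.
    by rewrite -pE mulrC mulKf.
  rewrite /u !wE; move: (poch c1 m) (poch _ m) c1m crm => *.
  by field; apply/andP.
have FS : dpower_series e (falling_coef e (c1 - 1) u r) x
    = poch (c1 - r%:R) r * F41 a b (c1 - r%:R) c2 t1 t2 k1 k2 x y.
  by rewrite /dpower_series fE; rewrite fE in cf; exact: limn_sq_sum_scale.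
rewrite FS poch_reflect mulrA [poch _ _ * _]mulrC.
by rewrite (_ : c1 - 1 - _ = c1 - r%:R - 1)//; ring.
Qed.

Lemma F41_term_swap_upper (a b c1 c2 t1 t2 : C) (k1 k2 : nat) :
  F41_term a b c1 c2 t1 t2 k1 k2 = F41_term b a c1 c2 t1 t2 k1 k2.
Proof.
apply/funext => x; apply/funext => y; apply/funext => m; apply/funext => n.
by rewrite /F41_term [poch a _ * _]mulrC.
Qed.

Lemma F41_term_swap (a b c1 c2 t1 t2 : C) (k1 k2 : nat) (x y : C) (m n : nat) :
  F41_term a b c1 c2 t1 t2 k1 k2 x y m n
    = F41_term a b c2 c1 t2 t1 k2 k1 y x n m.
Proof. by rewrite /F41_term addnC !invfM; ring. Qed.

Lemma F41_swap (a b c1 c2 t1 t2 : C) (k1 k2 : nat) (x y : C) :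
  F41 a b c1 c2 t1 t2 k1 k2 x y = F41 a b c2 c1 t2 t1 k2 k1 y x.
Proof.
congr (limn _); apply/funext => N; rewrite exchange_big/=.
by apply: eq_bigr => m _; apply: eq_bigr => n _; exact: F41_term_swap.
Qed.

Lemma F41_region_swap (x y : C) : F41_region x y -> F41_region y x.
Proof. by rewrite /F41_region addrC. Qed.

Lemma F41_abs_cvg_swap (a b c1 c2 t1 t2 : C) (k1 k2 : nat) :
  F41_abs_cvg a b c1 c2 t1 t2 k1 k2 -> F41_abs_cvg a b c2 c1 t2 t1 k2 k1.
Proof.
move=> Fc x y /F41_region_swap /Fc.
rewrite (_ : (fun N : nat => _) = fun N : nat => \sum_(m < N) \sum_(n < N)
    `|F41_term a b c2 c1 t2 t1 k2 k1 x y m n|)//.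
apply/funext => N; rewrite exchange_big/=.
by apply: eq_bigr => m _; apply: eq_bigr => n _; rewrite F41_term_swap.
Qed.

(** Exchanging the two variables together with the parameters attached to them
    turns the identities in y into those in x. *)
Lemma F41_diag_derivative_right (a b c1 c2 t1 t2 : C) (k1 k2 r : nat)
    (U : set C) (L : C -> C) (x y : C) :
  F41_abs_cvg a b c1 c2 t1 t2 k1 k2 -> log_branch U L ->
  U y -> F41_region (x * y) y ->
  is_nth_deriv r
    (fun z => cpow L (b + r%:R - 1) z
              * F41 a b c1 c2 t1 t2 k1 k2 (x * z) z) y
    (cpow L (b - 1) y * poch b r
     * F41 a (b + r%:R) c1 c2 t1 t2 k1 k2 (x * y) y).
Proof.
move=> /F41_abs_cvg_swap Fc UL Uy /F41_region_swap.
rewrite mulrC F41_swap => yx.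
rewrite (_ : (fun z => _) = (fun z => cpow L (b + r%:R - 1) z
    * F41 a b c2 c1 t2 t1 k2 k1 z (z * x))).
  exact: F41_diag_derivative UL _ _.
by apply/funext => z; rewrite F41_swap (mulrC x).
Qed.

End AppellFunction.

(** * The derivative formulas *)

Theorem theorem3p2 (R : realType) (k1 k2 : nat)
    (a b c1 c2 t1 t2 : R[i]^o) (r : nat) :
  (1 <= r)%N ->
  admissible_lower c1 -> admissible_lower c2 ->
  F41_abs_cvg a b c1 c2 t1 t2 k1 k2 ->
  forall (U : set R[i]^o) (L : R[i]^o -> R[i]^o), log_branch U L ->
  (forall x y : R[i]^o, U x -> F41_region x (x * y) ->
     is_nth_deriv r
       (fun z => cpow L (b + r%:R - 1) z
                 * F41 a b c1 c2 t1 t2 k1 k2 z (z * y)) x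
       (cpow L (b - 1) x * poch b r
        * F41 a (b + r%:R) c1 c2 t1 t2 k1 k2 x (x * y))) /\
  (forall x y : R[i]^o, U y -> F41_region (x * y) y ->
     is_nth_deriv r
       (fun z => cpow L (b + r%:R - 1) z
                 * F41 a b c1 c2 t1 t2 k1 k2 (x * z) z) y
       (cpow L (b - 1) y * poch b r
        * F41 a (b + r%:R) c1 c2 t1 t2 k1 k2 (x * y) y)) /\
  (forall x y : R[i]^o, U x -> F41_region x (x * y) ->
     is_nth_deriv r
       (fun z => cpow L (a + r%:R - 1) z
                 * F41 a b c1 c2 t1 t2 k1 k2 z (z * y)) x
       (cpow L (a - 1) x * poch a r
        * F41 (a + r%:R) b c1 c2 t1 t2 k1 k2 x (x * y))) /\
  (forall x y : R[i]^o, U y -> F41_region (x * y) y ->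
     is_nth_deriv r
       (fun z => cpow L (a + r%:R - 1) z
                 * F41 a b c1 c2 t1 t2 k1 k2 (x * z) z) y
       (cpow L (a - 1) y * poch a r
        * F41 (a + r%:R) b c1 c2 t1 t2 k1 k2 (x * y) y)) /\
  (admissible_lower (c1 - r%:R) ->
   forall x y : R[i]^o, U x -> F41_region x y ->
     is_nth_deriv r
       (fun z => cpow L (c1 - 1) z * F41 a b c1 c2 t1 t2 k1 k2 z y) x
       ((-1) ^+ r * poch (1 - c1) r * cpow L (c1 - r%:R - 1) x
        * F41 a b (c1 - r%:R) c2 t1 t2 k1 k2 x y)) /\
  (admissible_lower (c2 - r%:R) ->
   forall x y : R[i]^o, U y -> F41_region x y ->
     is_nth_deriv r
       (fun z => cpow L (c2 - 1) z * F41 a b c1 c2 t1 t2 k1 k2 x z) y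
       ((-1) ^+ r * poch (1 - c2) r * cpow L (c2 - r%:R - 1) y
        * F41 a b c1 (c2 - r%:R) t1 t2 k1 k2 x y)).
Proof.
move=> _ ac1 ac2 Fc U L UL.
have Fc' : F41_abs_cvg b a c1 c2 t1 t2 k1 k2.
  by rewrite /F41_abs_cvg F41_term_swap_upper.
have F41_swap_ab a' b' : F41 a' b' c1 c2 t1 t2 k1 k2
    = F41 b' a' c1 c2 t1 t2 k1 k2.
  by rewrite /F41 F41_term_swap_upper.
split; [|split; [|split; [|split; [|split]]]].
- by move=> x y Ux xy; exact: F41_diag_derivative Fc UL Ux xy.
- by move=> x y Uy xy; exact: F41_diag_derivative_right Fc UL Uy xy.
- move=> x y Ux xy; rewrite (F41_swap_ab a) (F41_swap_ab (a + _)).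
  exact: F41_diag_derivative Fc' UL Ux xy.
- move=> x y Uy xy; rewrite (F41_swap_ab a) (F41_swap_ab (a + _)).
  exact: F41_diag_derivative_right Fc' UL Uy xy.
- by move=> acr x y Ux xy; exact: F41_left_derivative ac1 acr Fc UL Ux xy.
- move=> acr x y Uy /F41_region_swap yx; rewrite F41_swap.
  rewrite (_ : (fun z => _) = (fun z => cpow L (c2 - 1) z
      * F41 a b c2 c1 t2 t1 k2 k1 z x)).
    have Fc2 := F41_abs_cvg_swap _ _ _ _ _ _ _ _ Fc.
    exact: F41_left_derivative ac2 acr Fc2 UL Uy yx.
  by apply/funext => z; rewrite F41_swap.
Qed.
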